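(* Let $n\ge 1$, let $f:\mathbb{F}_2^n\to\{0,1\}$ and let $A=\mathrm{supp}(f)=f^{-1}(1)$. Let $0<\eta<1$ and assume that the additive energy of $A$ satisfies $E(A)=|A|^{2+\eta}/n$. Then $$|\mathrm{supp}(f)|\ll |\mathrm{supp}(\widehat{f})|^{\frac{2}{1-\eta}},$$ i.e. $|\mathrm{supp}(f)|\le C\,|\mathrm{supp}(\widehat{f})|^{\frac{2}{1-\eta}}$ for a constant $C>0$ not depending on $n$ or $f$ (for fixed $\eta$), provided $\mathrm{supp}(f)$ is large enough (e.g. $n/|\mathrm{supp}(f)|\to 0$ as $n\to\infty$).
   Context: $\mathbb{F}_2^n$ is identified with $\{0,1\}^n$ and with the subsets of $[n]=\{1,\dots,n\}$ (a subset $S$ corresponds to the vector with $x_i=1$ iff $i\in S$). For $A\subseteq\mathbb{F}_2^n$, the additive energy is $E(A)=|\{(a_1,a_2,a_3,a_4)\in A^4: a_1+a_2=a_3+a_4\}|$. The Fourier transform of $f$ is $\widehat{f}(S)=\frac{1}{2^n}\sum_{x\in\{0,1\}^n} f(x)(-1)^{\langle S,x\rangle_2}$, where $\langle x,y\rangle_2=\sum_i x_iy_i \bmod 2$, and $\mathrm{supp}(\widehat{f})=\{S\subseteq[n]:\widehat{f}(S)\neq 0\}$. The notation $X\ll Y$ means $X\le CY$ for some constant $C>0$. *)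

(* Defs.v *)
From HB Require Import structures.
From mathcomp Require Import all_boot all_order all_algebra.
From mathcomp Require Import reals exp.

Set Implicit Arguments.
Unset Strict Implicit.
Unset Printing Implicit Defensive.

Import Order.TTheory GRing.Theory Num.Theory.
Local Open Scope ring_scope.

Definition supp (R : realType) (T : finType) (g : T -> R) : {set T} :=
  [set x | g x != 0].

(* The quadruple (a1, a2, a3, a4) is encoded as ((a1, a2), (a3, a4)). *)
Definition additive_energy (V : finZmodType) (A : {set V}) : nat :=
  #|[set a : (V * V) * (V * V) |
      [&& a.1.1 \in A, a.1.2 \in A, a.2.1 \in A, a.2.2 \in A
        & a.1.1 + a.1.2 == a.2.1 + a.2.2]]|.

Definition vec_of_set (n : nat) (S : {set 'I_n}) : 'rV['F_2]_n :=
  \row_(i < n) (i \in S)%:R.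

Definition dotF2 (n : nat) (x y : 'rV['F_2]_n) : 'F_2 :=
  \sum_(i < n) x 0 i * y 0 i.

(* The exponent is the representative in {0, 1} of the inner product. *)
Definition fourier (R : realType) (n : nat) (f : 'rV['F_2]_n -> R)
    (S : {set 'I_n}) : R :=
  (2 ^+ n)^-1 *
  \sum_(x : 'rV['F_2]_n) f x * (-1) ^+ nat_of_ord (dotF2 (vec_of_set S) x).

(* Main.v *)
(** Parseval applied to [f] and to the convolution of [f] with itself gives,
    for the unnormalised transform [F] of the indicator [f] of [A],
    [\sum_S F S ^+ 2 = 2 ^+ n * #|A|] and [\sum_S F S ^+ 4 = 2 ^+ n * E(A)].
    Cauchy-Schwarz on the support of [F] then yields
    [2 ^+ n * #|A| ^+ 2 <= #|supp F| * E(A)], and since [#|A| <= 2 ^+ n] the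
    energy hypothesis leaves [#|A| `^ (1 - eta) <= #|supp F|]: the exponent
    [1 / (1 - eta)] already suffices, with constant 1. *)
Require Import Defs.
From HB Require Import structures.
From mathcomp Require Import all_boot all_order all_algebra.
From mathcomp Require Import reals exp.
From mathcomp Require Import ring.

Import Order.TTheory GRing.Theory Num.Theory.
Local Open Scope ring_scope.

Lemma F2_eq01 (a : 'F_2) : a = 0 \/ a = 1.
Proof. by case: a => [[|[|//]] i]; [left|right]; apply: val_inj. Qed.

(** Cauchy-Schwarz against the constant 1: with [m = #|D|], the squared deviations
    [(m * F i - P) ^+ 2] sum to [m * (m * Q - P ^+ 2)]. The factor [m] is then cancelled, hence the
    separate case of empty [D]. *)
Lemma sum_sqr_le_card (R : realDomainType) (T : finType) (D : {set T})
    (F : T -> R) :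
  (\sum_(i in D) F i) ^+ 2 <= #|D|%:R * \sum_(i in D) F i ^+ 2.
Proof.
set m : R := #|D|%:R; set P := \sum_(i in D) F i; set Q := \sum_(i in D) _.
have [D0|D_gt0] := posnP #|D|.
  by rewrite /P (cards0_eq D0) big_set0 expr0n /= /m D0 mul0r.
have m_gt0 : 0 < m by rewrite ltr0n.
have : 0 <= \sum_(i in D) (m * F i - P) ^+ 2.
  by apply: sumr_ge0 => i _; apply: sqr_ge0.
have -> : \sum_(i in D) (m * F i - P) ^+ 2 = m * (m * Q - P ^+ 2).
  rewrite (eq_bigr (fun i => m ^+ 2 * F i ^+ 2 + (- (2 * m * P) * F i + P ^+ 2)));
    last by move=> i _; ring.
  rewrite !big_split /= -!mulr_sumr -/P -/Q sumr_const -mulr_natl -/m.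
  by ring.
by rewrite pmulr_rge0 // subr_ge0.
Qed.

Section Character.
Variables (R : realType) (n : nat).
Implicit Types (v w x y : 'rV['F_2]_n) (S : {set 'I_n}).

(** The frequency is a vector rather than a subset, so that [chi] is symmetric and is also a
    character in [v]. *)
Definition chi v x : R := (-1) ^+ nat_of_ord (dotF2 v x).

Lemma dotF2C v x : dotF2 v x = dotF2 x v.
Proof. by apply: eq_bigr => i _; rewrite mulrC. Qed.

Lemma dotF2D v x y : dotF2 v (x + y) = dotF2 v x + dotF2 v y.
Proof.
by rewrite -big_split; apply: eq_bigr => i _; rewrite mxE mulrDr.
Qed.

Lemma dotF2N v x : dotF2 v (- x) = - dotF2 v x.
Proof. by rewrite -sumrN; apply: eq_bigr => i _; rewrite mxE mulrN. Qed.

Lemma chiD v x y : chi v (x + y) = chi v x * chi v y.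
Proof.
rewrite /chi dotF2D; case: (F2_eq01 (dotF2 v x)) => ->;
  case: (F2_eq01 (dotF2 v y)) => ->; rewrite /= ?expr0 ?expr1 ?mulr1 ?mul1r //.
by rewrite mulrNN mulr1.
Qed.

Lemma chiN v x : chi v (- x) = chi v x.
Proof. by rewrite /chi dotF2N; case: (F2_eq01 (dotF2 v x)) => ->. Qed.

Lemma chiC v x : chi v x = chi x v.
Proof. by rewrite /chi dotF2C. Qed.

Lemma chi_delta i x : chi (delta_mx 0 i) x = (-1) ^+ nat_of_ord (x 0 i).
Proof.
rewrite /chi; suff -> : dotF2 (delta_mx 0 i) x = x 0 i by [].
rewrite /dotF2 (bigD1 i) //= big1 => [|j ji]; rewrite mxE.
  by rewrite !eqxx mul1r addr0.
by rewrite (negPf ji) andbF mul0r.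
Qed.

Lemma sum_chi x : \sum_v chi v x = (2 ^+ n) * (x == 0)%:R.
Proof.
have [->|/eqP x_neq0] := eqVneq x 0.
  have chi0 v : chi v 0 = 1.
    by rewrite /chi /dotF2 big1 // => i _; rewrite mxE mulr0.
  rewrite (eq_bigr _ (fun v _ => chi0 v)).
  by rewrite sumr_const card_mx card_Fp // mul1n mulr1 natrX.
have [i xi] : exists i, x 0 i = 1.
  have [/existsP [i /eqP ?]|/existsPn x0] := boolP [exists i, x 0 i == 1].
    by exists i.
  case: x_neq0; apply/rowP => i; rewrite mxE.
  by case: (F2_eq01 (x 0 i)) => // xi; move: (x0 i); rewrite xi eqxx.
rewrite mulr0; set s := \sum_v _.
(* Translating [v] by the [i]-th basis vector flips every sign. *)
have : s = - s.
  rewrite {1}/s (reindex_inj (addrI (delta_mx 0 i))) -sumrN.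
  by apply: eq_bigr => v _; rewrite chiC chiD !(chiC x) chi_delta xi mulN1r.
by move/eqP; rewrite -addr_eq0 -mulr2n mulrn_eq0 => /eqP.
Qed.

Lemma parseval (g : 'rV['F_2]_n -> R) :
  \sum_v (\sum_x g x * chi v x) ^+ 2 = 2 ^+ n * \sum_x g x ^+ 2.
Proof.
under eq_bigr => v _.
  rewrite expr2 big_distrlr /=.
  under eq_bigr => x _ do under eq_bigr => y _ do
    (* The sign, harmless in characteristic 2, produces [chi v (x - y)], so that orthogonality
       leaves only the diagonal [y = x]. *)
    rewrite mulrACA -(chiN v y) -chiD.
  over.
rewrite exchange_big mulr_sumr; apply: eq_bigr => x _.
rewrite exchange_big (bigD1 x) //= [X in _ + X]big1 => [|y yx];
  rewrite -mulr_sumr sum_chi subr_eq0.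
  by rewrite eqxx addr0 mulr1 mulrC expr2.
by rewrite eq_sym (negPf yx) !mulr0.
Qed.

Definition conv_sqr (g : 'rV['F_2]_n -> R) z : R :=
  \sum_(p : 'rV['F_2]_n * 'rV['F_2]_n | p.1 + p.2 == z) g p.1 * g p.2.

(** Multiplicativity of [chi v] allows grouping the pairs of the expanded square by their sum. *)
Lemma transform_conv_sqr (g : 'rV['F_2]_n -> R) v :
  (\sum_x g x * chi v x) ^+ 2 = \sum_z conv_sqr g z * chi v z.
Proof.
rewrite expr2 big_distrlr pair_bigA /=.
rewrite (partition_big (fun p => p.1 + p.2) predT) //=.
apply: eq_bigr => z _; rewrite mulr_suml; apply: eq_bigr => p /eqP <-.
by rewrite mulrACA chiD.
Qed.

(** For an indicator, [conv_sqr] at [z] counts the representations of [z] as a sum of two elements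
    of [A]; its square counts pairs of representations, and each energy quadruple has exactly one
    common sum [z]. *)
Lemma energy_conv_sqr (A : {set 'rV['F_2]_n}) :
  (additive_energy A)%:R = \sum_z conv_sqr (fun x => (x \in A)%:R) z ^+ 2.
Proof.
under eq_bigr do rewrite expr2 mulr_suml.
rewrite (exchange_big_dep predT) //=.
under eq_bigr => p _.
  rewrite (big_pred1 (p.1 + p.2)) => [|z]; last exact: eq_sym.
  rewrite mulr_sumr big_mkcond.
  over.
rewrite pair_bigA /additive_energy -sum1_card natr_sum big_mkcond.
apply: eq_bigr => -[p q] _; rewrite inE /= eq_sym.
case: eqP => _; last by rewrite !andbF.
by rewrite -!natrM !mulnb andbT !andbA; case: (_ && _).
Qed.

(** Carries sums over subsets, which index [fourier], to the vector frequencies of [parseval]. *)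
Lemma sum_vec_of_set (G : 'rV['F_2]_n -> R) :
  \sum_S G (vec_of_set S) = \sum_v G v.
Proof.
pose set_of v := [set i | v 0 i == 1].
rewrite [RHS](reindex (@vec_of_set n)) //.
exists set_of => [S _|v _].
  by apply/setP => i; rewrite inE mxE; case: (i \in S).
apply/rowP => i; rewrite mxE inE.
by case: (F2_eq01 (v 0 i)) => ->.
Qed.

Lemma card_supp_fourier_energy (f : 'rV['F_2]_n -> R) :
  (forall x, f x = 0 \/ f x = 1) ->
  2 ^+ n * #|supp f|%:R ^+ 2 <=
    #|supp (fourier f)|%:R * (additive_energy (supp f))%:R :> R.
Proof.
move=> f01; have fE x : f x = (x \in supp f)%:R.
  by rewrite inE; case: (f01 x) => ->; rewrite ?eqxx ?oner_eq0.
pose F v := \sum_x f x * chi v x.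
have N_gt0 : 0 < 2 ^+ n :> R by rewrite exprn_gt0.
have FE S : (S \in supp (fourier f)) = (F (vec_of_set S) != 0).
  by rewrite inE /fourier mulf_eq0 invr_eq0 (gt_eqF N_gt0).
(* A positive exponent makes the terms off the support vanish, whereas [0 ^+ 0 = 1]. *)
have sum_supp k : \sum_(S in supp (fourier f)) F (vec_of_set S) ^+ k.+1 =
    \sum_v F v ^+ k.+1.
  rewrite -(sum_vec_of_set (fun v => F v ^+ k.+1)) big_mkcond.
  by apply: eq_bigr => S _; rewrite FE; case: eqP => //= ->; rewrite expr0n.
have sum2 : \sum_v F v ^+ 2 = 2 ^+ n * #|supp f|%:R.
  rewrite parseval -sum1_card natr_sum [in RHS]big_mkcond; congr (_ * _).
  by apply: eq_bigr => x _; rewrite fE; case: ifP; rewrite ?expr1n ?expr0n.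
have sum4 : \sum_v F v ^+ 4 = 2 ^+ n * (additive_energy (supp f))%:R.
  under eq_bigr do rewrite (exprM _ 2 2) transform_conv_sqr.
  rewrite parseval energy_conv_sqr; congr (_ * _).
  by apply: eq_bigr => z _; congr (_ ^+ 2); apply: eq_bigr => p _; rewrite -!fE.
have := @sum_sqr_le_card R _ (supp (fourier f)) (fun S => F (vec_of_set S) ^+ 2).
under [in X in _ <= X]eq_bigr do rewrite -exprM.
rewrite !sum_supp sum2 sum4 mulrCA exprMn expr2 -mulrA.
by rewrite ler_pM2l.
Qed.

End Character.

Theorem theorem1 (R : realType) (eta : R) (eta_gt0 : 0 < eta) (eta_lt1 : eta < 1) :
  exists C : R, 0 < C /\
  exists eps : R, 0 < eps /\
  forall (n : nat) (f : 'rV['F_2]_n -> R),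
    (1 <= n)%N ->
    (forall x, f x = 0 \/ f x = 1) ->
    (additive_energy (supp f))%:R = (#|supp f|%:R) `^ (2 + eta) / n%:R :> R ->
    n%:R <= eps * #|supp f|%:R ->
    #|supp f|%:R <= C * (#|supp (fourier f)|%:R) `^ (2 / (1 - eta)).
Proof.
exists 1; split=> //; exists 1; split=> // n f n_gt0 f01 energyE _.
rewrite mul1r; have [->|a_gt0] := posnP #|supp f|; first exact: powR_ge0.
have := card_supp_fourier_energy R n f f01; rewrite energyE.
have : #|supp f|%:R <= 2 ^+ n :> R.
  rewrite -natrX ler_nat (leq_trans (max_card _)) //.
  by rewrite card_mx card_Fp // mul1n.
have : 1 <= #|supp f|%:R :> R by rewrite ler1n.
have : 1 <= n%:R :> R by rewrite ler1n.
have : 0 <= #|supp (fourier f)|%:R :> R by [].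
(* Only real inequalities remain, with [a] the size of the support, [s] that of the Fourier support,
   [N = 2 ^+ n] and [m = n]. *)
move: (#|supp f|%:R : R) (#|supp (fourier f)|%:R : R) (2 ^+ n) (n%:R : R).
move=> a s N m s_ge0 m_ge1 a_ge1 aN.
have {}a_gt0 : 0 < a by apply: lt_le_trans a_ge1.
have m_gt0 : 0 < m by apply: lt_le_trans m_ge1.
have e_gt0 : 0 < 1 - eta by rewrite subr_gt0.
rewrite powRD ?(gt_eqF a_gt0) ?implybT // powR_mulrn ?(ltW a_gt0) //.
rewrite mulrA ler_pdivlMr // (mulrC N) -mulrA (mulrCA s).
rewrite ler_pM2l ?exprn_gt0 // => Nm_le.
have a_le : a <= s * a `^ eta.
  apply: le_trans Nm_le; apply: (le_trans aN).
  by apply: ler_peMr m_ge1; apply: le_trans aN; apply: ltW.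
have a_powR : a `^ (1 - eta) <= s.
  by rewrite powRB ?(gt_eqF a_gt0) ?implybT // powRr1 ?(ltW a_gt0) // ler_pdivrMr ?powR_gt0.
(* Raising the exponent from [1 / (1 - eta)] to [2 / (1 - eta)] at the end requires a base at least
   1. *)
have s_ge1 : 1 <= s.
  by apply: le_trans a_powR; rewrite -[leLHS](powRr0 a) ler_powR // ltW.
have -> : a = (a `^ (1 - eta)) `^ (1 - eta)^-1.
  by rewrite -powRrM mulfV ?gt_eqF // powRr1 // ltW.
apply: (@le_trans _ _ (s `^ (1 - eta)^-1)).
  by rewrite ge0_ler_powR ?nnegrE ?invr_ge0 ?powR_ge0 // ltW.
by apply: ler_powR => //; rewrite ler_peMl ?invr_ge0 ?(ltW e_gt0) // ler1n.
Qed.
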